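(* Let $(M,H,G)$ be a quaternionic Kähler NH-manifold with associated local 1-forms $\omega_1,\omega_2,\omega_3$. Then $(M,g)$ is flat if and only if $$d\omega_1(x,y)=-\omega_2(x)\omega_3(y)+\omega_3(x)\omega_2(y)$$ for all $x,y$.
   Context: $M$ is a smooth manifold of dimension $4n$. An almost hypercomplex structure on $M$ is a triple $H=(J_1,J_2,J_3)$ of almost complex structures with $J_\alpha=J_\beta\circ J_\gamma=-J_\gamma\circ J_\beta$ and $J_\alpha^2=-I$ for all cyclic permutations $(\alpha,\beta,\gamma)$ of $(1,2,3)$. Put $\varepsilon_1=1$, $\varepsilon_2=\varepsilon_3=-1$. An NH-metric structure $G=(g,g_1,g_2,g_3)$ on $(M,H)$ consists of a pseudo-Riemannian metric $g$ of neutral signature $(2n,2n)$ with $g(x,y)=\varepsilon_\alpha g(J_\alpha x,J_\alpha y)$ for $\alpha=1,2,3$, together with $g_\alpha(x,y)=g(J_\alpha x,y)=-\varepsilon_\alpha g(x,J_\alpha y)$. $(M,H,G)$ is then an almost hypercomplex NH-manifold. Let $\nabla$ be the Levi-Civita connection of $g$. $(M,H,G)$ is a quaternionic Kähler NH-manifold if there are (local) 1-forms $\omega_1,\omega_2,\omega_3$ with $(\nabla_xJ_\alpha)y=\omega_\gamma(x)J_\beta y-\omega_\beta(x)J_\gamma y$ for all cyclic permutations $(\alpha,\beta,\gamma)$ of $(1,2,3)$. Convention: $d\omega(x,y)=(\nabla_x\omega)(y)-(\nabla_y\omega)(x)$. Flat means that the curvature tensor of $\nabla$ vanishes. *)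

(* Defs.v *)
From HB Require Import structures.
From mathcomp Require Import all_boot all_order all_algebra.
From mathcomp Require Import all_classical all_reals all_analysis.

Set Implicit Arguments.
Unset Strict Implicit.
Unset Printing Implicit Defensive.

Import Order.TTheory GRing.Theory Num.Theory.
Import numFieldNormedType.Exports.

Local Open Scope classical_set_scope.
Local Open Scope ring_scope.

(* Points of R^m and components of tangent vectors are column vectors, so that
   an endomorphism acts by [A *m v] and composition is the matrix product.
   Components of 1-forms are row vectors. *)

Definition basis_vec (R : realType) (m : nat) (j : 'I_m) : 'cV[R]_m :=
  delta_mx j 0.

(* C^k by iterated partial derivatives; meant for an open U. *)
Fixpoint Ck_on (R : realType) (m : nat) (W : normedModType R) (k : nat)
    (U : set 'cV[R]_m) (f : 'cV[R]_m -> W) : Prop :=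
  (forall x, U x -> {for x, continuous f}) /\
  match k with
  | 0%N => True
  | k'.+1 => forall j : 'I_m,
      (forall x, U x -> derivable f x (basis_vec R j)) /\
      Ck_on k' U ('D_(basis_vec R j) f)
  end.

Definition smooth_on (R : realType) (m : nat) (W : normedModType R)
    (U : set 'cV[R]_m) (f : 'cV[R]_m -> W) : Prop :=
  forall k, Ck_on k U f.

(* The smooth structure is given by a (not necessarily maximal) smooth atlas.
   The maps [coord c] and [point c] are total functions, meaningful only on
   [dom c] and on its image. *)
Record smooth_manifold (R : realType) (m : nat) := SmoothManifold {
  space :> topologicalType;
  space_hausdorff : hausdorff_space space;
  space_second_countable : @second_countable space;
  chart : Type;
  dom : chart -> set space;
  coord : chart -> space -> 'cV[R]_m;
  point : chart -> 'cV[R]_m -> space;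
  dom_open : forall c, open (dom c);
  dom_cover : forall p, exists c, dom c p;
  codom_open : forall c, open (coord c @` dom c);
  coordK : forall c p, dom c p -> point c (coord c p) = p;
  coord_continuous : forall c p, dom c p -> {for p, continuous (coord c)};
  point_continuous : forall c x,
    (coord c @` dom c) x -> {for x, continuous (point c)};
  transition_smooth : forall c c',
    smooth_on (coord c @` (dom c `&` dom c')) (coord c' \o point c)
}.

(* Image in the chart c of the part of A lying in the domain of c. *)
Definition in_chart (R : realType) (m : nat) (M : smooth_manifold R m)
    (c : chart M) (A : set M) : set 'cV[R]_m :=
  coord c @` (dom c `&` A).

Definition transition (R : realType) (m : nat) (M : smooth_manifold R m)
    (c c' : chart M) : 'cV[R]_m -> 'cV[R]_m :=
  coord c' \o point c.

Definition jac (R : realType) (m : nat) (M : smooth_manifold R m)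
    (c c' : chart M) (x : 'cV[R]_m) : 'M[R]_m :=
  \matrix_(i, j) ('D_(basis_vec R j) (transition c c') x) i 0.

(* Tensor fields are families of components, one for each chart, obeying the
   transformation law of their type. *)

Record endo_field (R : realType) (m : nat) (M : smooth_manifold R m) :=
  EndoField {
  endo_at :> chart M -> 'cV[R]_m -> 'M[R]_m;
  endo_smooth : forall c, smooth_on (in_chart c setT) (endo_at c);
  endo_transform : forall c c' x, in_chart c (dom c') x ->
    jac c c' x *m endo_at c x = endo_at c' (transition c c' x) *m jac c c' x
}.

Record bilinear_field (R : realType) (m : nat) (M : smooth_manifold R m) :=
  BilinearField {
  bilinear_at :> chart M -> 'cV[R]_m -> 'M[R]_m;
  bilinear_smooth : forall c, smooth_on (in_chart c setT) (bilinear_at c);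
  bilinear_transform : forall c c' x, in_chart c (dom c') x ->
    bilinear_at c x =
      (jac c c' x)^T *m bilinear_at c' (transition c c' x) *m jac c c' x
}.

Record one_form (R : realType) (m : nat) (M : smooth_manifold R m)
    (U : set M) := OneForm {
  form_at :> chart M -> 'cV[R]_m -> 'rV[R]_m;
  form_smooth : forall c, smooth_on (in_chart c U) (form_at c);
  form_transform : forall c c' x, in_chart c (dom c' `&` U) x ->
    form_at c x = form_at c' (transition c c' x) *m jac c c' x
}.

Definition ev_form (R : realType) (m : nat) (a : 'rV[R]_m) (v : 'cV[R]_m) : R :=
  (a *m v) 0 0.

Definition ev_bil (R : realType) (m : nat) (B : 'M[R]_m) (u v : 'cV[R]_m) : R :=
  (u^T *m B *m v) 0 0.

(* Christoffel symbols in a chart: [Gam x i k j] is Gamma^k_(i j), where i is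
   the direction of differentiation; [conn_mx (Gam x) v] is Gamma(v, .). *)
Definition conn_mx (R : realType) (m : nat) (G : 'I_m -> 'M[R]_m)
    (v : 'cV[R]_m) : 'M[R]_m :=
  \sum_(i < m) v i 0 *: G i.

(* The transformation law expresses that the local operators [cov] below glue:
   A (nabla_v Y) = nabla'_(A v) (A Y), with A the Jacobian of the transition. *)
Record affine_connection (R : realType) (m : nat) (M : smooth_manifold R m) :=
  AffineConnection {
  christoffel :> chart M -> 'cV[R]_m -> 'I_m -> 'M[R]_m;
  christoffel_smooth : forall c i,
    smooth_on (in_chart c setT) (fun x => christoffel c x i);
  christoffel_transform : forall c c' x (v : 'cV[R]_m),
    in_chart c (dom c') x ->
    jac c c' x *m conn_mx (christoffel c x) v =
      'D_v (jac c c') x +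
      conn_mx (christoffel c' (transition c c' x)) (jac c c' x *m v)
        *m jac c c' x
}.

(* Operators on vector fields in coordinates: (nabla_X Y)(x) and [X, Y](x). *)
Definition cov (R : realType) (m : nat) (Gam : 'cV[R]_m -> 'I_m -> 'M[R]_m)
    (X Y : 'cV[R]_m -> 'cV[R]_m) (x : 'cV[R]_m) : 'cV[R]_m :=
  'D_(X x) Y x + conn_mx (Gam x) (X x) *m Y x.

Definition lie (R : realType) (m : nat) (X Y : 'cV[R]_m -> 'cV[R]_m)
    (x : 'cV[R]_m) : 'cV[R]_m :=
  'D_(X x) Y x - 'D_(Y x) X x.

(* The following expressions are tensorial in u, v, w, so they are evaluated
   on the extensions of u, v, w with constant components in the chart. *)

Definition torsion (R : realType) (m : nat)
    (Gam : 'cV[R]_m -> 'I_m -> 'M[R]_m) (x u v : 'cV[R]_m) : 'cV[R]_m :=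
  cov Gam (cst u) (cst v) x - cov Gam (cst v) (cst u) x
  - lie (cst u) (cst v) x.

(* R(u, v) w = nabla_u nabla_v w - nabla_v nabla_u w - nabla_[u, v] w *)
Definition curvature (R : realType) (m : nat)
    (Gam : 'cV[R]_m -> 'I_m -> 'M[R]_m) (x u v w : 'cV[R]_m) : 'cV[R]_m :=
  cov Gam (cst u) (cov Gam (cst v) (cst w)) x
  - cov Gam (cst v) (cov Gam (cst u) (cst w)) x
  - cov Gam (lie (cst u) (cst v)) (cst w) x.

(* (nabla_u B)(v, w) *)
Definition nabla_bilinear (R : realType) (m : nat)
    (Gam : 'cV[R]_m -> 'I_m -> 'M[R]_m) (B : 'cV[R]_m -> 'M[R]_m)
    (x u v w : 'cV[R]_m) : R :=
  'D_u (fun y => ev_bil (B y) v w : R) x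
  - ev_bil (B x) (cov Gam (cst u) (cst v) x) w
  - ev_bil (B x) v (cov Gam (cst u) (cst w) x).

(* (nabla_u A) v *)
Definition nabla_endo (R : realType) (m : nat)
    (Gam : 'cV[R]_m -> 'I_m -> 'M[R]_m) (A : 'cV[R]_m -> 'M[R]_m)
    (x u v : 'cV[R]_m) : 'cV[R]_m :=
  cov Gam (cst u) (fun y => A y *m v) x - A x *m cov Gam (cst u) (cst v) x.

(* (nabla_u a) v *)
Definition nabla_form (R : realType) (m : nat)
    (Gam : 'cV[R]_m -> 'I_m -> 'M[R]_m) (a : 'cV[R]_m -> 'rV[R]_m)
    (x u v : 'cV[R]_m) : R :=
  'D_u (fun y => ev_form (a y) v : R) x
  - ev_form (a x) (cov Gam (cst u) (cst v) x).

Definition ext_d (R : realType) (m : nat)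
    (Gam : 'cV[R]_m -> 'I_m -> 'M[R]_m) (a : 'cV[R]_m -> 'rV[R]_m)
    (x u v : 'cV[R]_m) : R :=
  nabla_form Gam a x u v - nabla_form Gam a x v u.

(* Sylvester normal form: p entries 1, then m - p entries -1; such a form is
   in particular nondegenerate. *)
Definition has_signature (R : realType) (m : nat) (p : nat) (B : 'M[R]_m) :
    Prop :=
  exists2 P : 'M[R]_m, P \in unitmx &
    P^T *m B *m P = diag_mx (\row_(i < m) (if (i < p)%N then 1 else -1)).

Definition pseudo_metric (R : realType) (m : nat) (M : smooth_manifold R m)
    (p : nat) (g : bilinear_field M) : Prop :=
  forall c x, in_chart c setT x ->
    (forall u v, ev_bil (g c x) u v = ev_bil (g c x) v u) /\
    has_signature p (g c x).

Definition levi_civita (R : realType) (m : nat) (M : smooth_manifold R m)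
    (g : bilinear_field M) (nabla : affine_connection M) : Prop :=
  forall c x, in_chart c setT x ->
    (forall u v, torsion (nabla c) x u v = 0) /\
    (forall u v w, nabla_bilinear (nabla c) (g c) x u v w = 0).

Definition flat (R : realType) (m : nat) (M : smooth_manifold R m)
    (nabla : affine_connection M) : Prop :=
  forall c x, in_chart c setT x ->
    forall u v w, curvature (nabla c) x u v w = 0.

(* The index set {1, 2, 3}.  As [ordS] is the cyclic successor, the cyclic
   permutations of (1, 2, 3) are the triples (a, ordS a, ordS (ordS a)). *)
Definition i1 : 'I_3 := ord0.
Definition i2 : 'I_3 := ordS i1.
Definition i3 : 'I_3 := ordS i2.

Definition eps (R : realType) (a : 'I_3) : R := if a == i1 then 1 else -1.

Definition almost_hypercomplex (R : realType) (m : nat)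
    (M : smooth_manifold R m) (J : 'I_3 -> endo_field M) : Prop :=
  forall c x, in_chart c setT x -> forall a : 'I_3,
    let b := ordS a in let d := ordS b in
    [/\ J a c x = J b c x *m J d c x,
        J a c x = - (J d c x *m J b c x) &
        J a c x *m J a c x = - 1%:M].

Definition NH_metric_structure (R : realType) (n : nat)
    (M : smooth_manifold R (4 * n)) (J : 'I_3 -> endo_field M)
    (g : bilinear_field M) (gJ : 'I_3 -> bilinear_field M) : Prop :=
  pseudo_metric (2 * n) g /\
  forall c x, in_chart c setT x -> forall (a : 'I_3) u v,
    [/\ ev_bil (g c x) u v =
          eps R a * ev_bil (g c x) (J a c x *m u) (J a c x *m v),
        ev_bil (gJ a c x) u v = ev_bil (g c x) (J a c x *m u) v &
        ev_bil (gJ a c x) u v =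
          - eps R a * ev_bil (g c x) u (J a c x *m v)].

(* The local 1-forms: a triple of 1-forms on each member of an open cover. *)
Definition quaternionic_kahler (R : realType) (m : nat)
    (M : smooth_manifold R m) (J : 'I_3 -> endo_field M)
    (nabla : affine_connection M) (I : Type) (U : I -> set M)
    (omega : forall i : I, 'I_3 -> one_form (U i)) : Prop :=
  [/\ forall i, open (U i),
      forall p, exists i, U i p &
      forall i c x, in_chart c (U i) x -> forall (a : 'I_3) u v,
        let b := ordS a in let d := ordS b in
        nabla_endo (nabla c) (J a c) x u v =
          ev_form (omega i d c x) u *: (J b c x *m v)
          - ev_form (omega i b c x) u *: (J d c x *m v)].

(* Main.v *)
Require Import Defs.
From HB Require Import structures.
From mathcomp Require Import all_boot all_order all_algebra.
From mathcomp Require Import all_classical all_reals all_analysis.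
From mathcomp Require Import ring lra.

Set Implicit Arguments.
Unset Strict Implicit.
Unset Printing Implicit Defensive.

Import Order.TTheory GRing.Theory Num.Theory.
Import numFieldNormedType.Exports.

Local Open Scope classical_set_scope.
Local Open Scope ring_scope.

(** The metric makes [J i1] skew and [J i2], [J i3] self-adjoint.  Covariant
    differentiation along a connection preserving the metric keeps self-adjoint
    endomorphisms self-adjoint ([nabla_endo_selfadjoint]), whereas the structure
    equations put a multiple of the skew endomorphism [J i1] into the
    derivatives of [J i2] and [J i3].  In positive dimension this forces
    omega_2 = omega_3 = 0 ([omega2_eq0], [omega3_eq0]): the right-hand side of
    the criterion is zero, and the criterion says that omega_1 is closed.

    Now J_2 and J_3 are rotated into each other with connection form omega_1.
    Comparing the two orders of second covariant differentiation
    ([curv_mx_rotation]) gives [R(u, v), J_2] = d omega_1(u, v) J_3 and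
    [R(u, v), J_3] = - d omega_1(u, v) J_2.  If R = 0, then d omega_1 = 0
    because J_3 is invertible.  Conversely, if d omega_1 = 0, every R(u, v)
    commutes with the self-adjoint J_2 and J_3.  The symmetries of a
    Riemannian curvature tensor then allow J_2 and J_3 to be moved freely
    between all four slots ([pure_of_symmetric]), which is incompatible with
    J_2 J_3 = - J_3 J_2 unless R = 0 ([curvature_like_eq0]).

    The analytic input is the calculus of C^k functions given by iterated
    partial derivatives: derivatives in arbitrary directions
    ([Ck_on_is_derive]) and the equality of mixed derivatives ([schwarz]).  In
    dimension 0 both sides of the equivalence hold trivially. *)

(** * Directional derivatives *)

Section DirectionalDerivatives.
Variables (R : realType) (V : normedModType R).
Implicit Types (f : V -> R) (x y u v w : V).

Lemma is_derive_line f y w (t : R) : derivable f (y + t *: w) w ->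
  is_derive t (1 : R) (fun s => f (y + s *: w)) ('D_w f (y + t *: w)).
Proof.
have E : (fun h : R => h^-1 *: (((fun s => f (y + s *: w)) \o shift t) (h *: 1)
            - f (y + t *: w))) =
         (fun h : R => h^-1 *: ((f \o shift (y + t *: w)) (h *: w)
            - f (y + t *: w))).
  apply/funext => h /=; congr (_ *: (f _ - _)).
  by rewrite scalerDl -[h *: 1]/(h * 1) mulr1 addrCA.
by move=> df; split; rewrite /derivable /derive E.
Qed.

Lemma is_derive_scale f x v (c : R) : derivable f x v ->
  is_derive x (c *: v) f (c * 'D_v f x).
Proof.
move=> df.
have [->|c0] := eqVneq c 0; first by rewrite scale0r mul0r; apply: is_derive0.
have E : (fun h : R => h^-1 *: ((f \o shift x) (h *: (c *: v)) - f x)) =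
         (fun h => c * ((h * c)^-1 *: ((f \o shift x) ((h * c) *: v) - f x))).
  apply/funext => h /=; rewrite scalerA invfM -[_ *: _]/(_ * _) mulrA.
  by rewrite [_ / c]mulrC !mulrA divff// mul1r.
have L : (fun h : R => h^-1 *: ((f \o shift x) (h *: (c *: v)) - f x)) @ 0^'
    --> c * 'D_v f x.
  rewrite E; apply: cvgM; first exact: cvg_cst.
  apply: (cvg_comp (fun h => h * c) (fun k => k^-1 *:
    ((f \o shift x) (k *: v) - f x)) _ df) => A [e /= e0 eA].
  exists (e / `|c|) => /=; first by rewrite divr_gt0 ?normr_gt0.
  move=> h /=; rewrite sub0r normrN ltr_pdivlMr ?normr_gt0// => he h0.
  by apply: eA; rewrite /= ?sub0r ?normrN ?normrM// mulf_neq0.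
by split; [apply/cvg_ex; exists (c * 'D_v f x)|exact: cvg_lim L].
Qed.

(** The parameter runs over the whole segment from y to y + w, so that a step
    h w with h of either sign is covered by rescaling the direction. *)
Lemma MVT_line f y w :
  (forall t : R, 0 <= t <= 1 -> derivable f (y + t *: w) w) ->
  exists2 t : R, 0 <= t <= 1 & f (y + w) - f y = 'D_w f (y + t *: w).
Proof.
move=> df.
have dg (t : R) : t \in `[0, 1] ->
    is_derive t (1 : R) (fun s => f (y + s *: w)) ('D_w f (y + t *: w)).
  by rewrite in_itv /= => /df; exact: is_derive_line.
have cg : {within `[0 : R, 1], continuous (fun s : R => f (y + s *: w))}.
  by apply: derivable_within_continuous => t /dg [].
have dg' (t : R) : t \in `]0, 1[ ->
    is_derive t (1 : R) (fun s => f (y + s *: w)) ('D_w f (y + t *: w)).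
  by move=> /subset_itv_oo_cc; exact: dg.
have [t t01] := MVT_segment (@ler01 R) dg' cg.
rewrite scale1r scale0r addr0 subr0 mulr1 => E.
by exists t => //; move: t01; rewrite in_itv.
Qed.

(** Intermediate points produced by the mean value theorem near x have this
    form; uniformity in s and t lets them be chosen after h. *)
Lemma near_parallelogram (P : V -> Prop) x v w :
  (\forall y \near x, P y) ->
  \forall h \near (0 : R), forall s t : R, 0 <= s <= 1 -> 0 <= t <= 1 ->
    P (x + (h * s) *: v + (h * t) *: w).
Proof.
move=> /nbhs_ballP[e /= e0 eP]; apply/nbhs_ballP.
have k0 : 0 < `|v| + `|w| + 1 by rewrite ltr_pwDr// addr_ge0.
exists (e / (`|v| + `|w| + 1)) => /=; first exact: divr_gt0.
move=> h; rewrite -ball_normE /= sub0r normrN ltr_pdivlMr// => he s t s01 t01.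
apply: eP; rewrite -ball_normE /= -addrA opprD addNKr normrN.
apply: le_lt_trans he; apply: (le_trans (ler_normD _ _)).
have B (r : R) z : 0 <= r <= 1 -> `|(h * r) *: z| <= `|h| * `|z|.
  case/andP=> r0 r1; rewrite normrZ normrM (ger0_norm r0).
  by apply: ler_wpM2r => //; rewrite ler_piMr.
by rewrite !mulrDr mulr1 ler_wpDr// lerD// B.
Qed.

(** Only the second direction needs a continuous derivative: the increment
    along h (v + c w) splits at x + h v, and the mean value theorem turns the
    second part into c times the derivative at a point converging to x.
    Iterating over a basis gives all directional derivatives. *)
Lemma is_derive_dirD f x v w (a c : R) : is_derive x v f a ->
  (\forall y \near x, derivable f y w) -> {for x, continuous ('D_w f)} ->
  is_derive x (v + c *: w) f (a + c * 'D_w f x).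
Proof.
move=> [dfv <-] dfw cfw.
suff L : (fun h : R => h^-1 *: ((f \o shift x) (h *: (v + c *: w)) - f x))
    @ 0^' --> 'D_v f x + c * 'D_w f x.
  by split; [apply/cvg_ex; eexists; exact: L|exact: cvg_lim L].
pose r (h : R) := h^-1 *: ((f \o shift x) (h *: v) - f x).
rewrite (_ : (fun h => _) = r + (fun h : R => h^-1 *:
  (f (x + h *: v + h *: (c *: w)) - f (x + h *: v)))); last first.
  apply/funext => h /=; rewrite -[RHS]/(r h + _ *: _) /r /= -scalerDr.
  congr (_ *: _); rewrite [h *: v + x]addrC [RHS]addrC subrKA.
  by congr (f _ - _); rewrite scalerDr addrC addrA.
apply: cvgD; first exact: dfv.
apply/cvgrPdist_lt => e e0; rewrite near_withinE.
have near_x : \forall y \near x,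
    derivable f y w /\ `|c * 'D_w f x - c * 'D_w f y| < e.
  apply: filterI => //.
  have : (fun y => c * 'D_w f y) @ x --> c * 'D_w f x.
    by apply: cvgM; [exact: cvg_cst|exact: cfw].
  by move/cvgrPdist_lt; apply.
have I1 : 0 <= (1 : R) <= 1 by apply/andP; split.
apply: filterS (near_parallelogram v (c *: w) near_x) => h H h0.
have dfh (t : R) : 0 <= t <= 1 ->
    is_derive (x + h *: v + t *: (h *: (c *: w))) (h *: (c *: w)) f
      (h * c * 'D_w f (x + (h * 1) *: v + (h * t) *: (c *: w))).
  move=> t01; have [+ _] := H 1 t I1 t01.
  rewrite mulr1 ![_ *: (_ *: (c *: w))]scalerA [t * h]mulrC => /is_derive_scale.
  by rewrite [h *: (c *: w)]scalerA; exact.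
have [t t01 ->] : exists2 t : R, 0 <= t <= 1 &
    f (x + h *: v + h *: (c *: w)) - f (x + h *: v) =
      'D_(h *: (c *: w)) f (x + h *: v + t *: (h *: (c *: w))).
  by apply: MVT_line => t t01; have [D _] := dfh t t01; exact: D.
have [_ ->] := dfh t t01; have [_] := H 1 t I1 t01.
by rewrite -[_ *: (_ * _)]/(_ * (_ * _)) -mulrA mulKf.
Qed.

Lemma is_derive_translate f c x w : derivable f (x + c) w ->
  is_derive x w (fun y => f (y + c)) ('D_w f (x + c)).
Proof.
have E : (fun h : R => h^-1 *: (((fun y => f (y + c)) \o shift x) (h *: w)
            - f (x + c))) =
         (fun h => h^-1 *: ((f \o shift (x + c)) (h *: w) - f (x + c))).
  by apply/funext => h /=; rewrite addrA.
by move=> df; split; rewrite /derivable /derive E.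
Qed.

(** The second difference is an increment in direction v of the increment of f
    in direction u; applying the mean value theorem to each increment exhibits
    the mixed derivative at a nearby point. *)
Lemma second_difference f x u v (h : R) :
  (forall s t : R, 0 <= s <= 1 -> 0 <= t <= 1 ->
     derivable f (x + (h * s) *: u + (h * t) *: v) u /\
     derivable ('D_u f) (x + (h * s) *: u + (h * t) *: v) v) ->
  exists s t : R, [/\ 0 <= s <= 1, 0 <= t <= 1 &
    f (x + h *: u + h *: v) - f (x + h *: u) - (f (x + h *: v) - f x) =
      h * (h * 'D_v ('D_u f) (x + (h * s) *: u + (h * t) *: v))].
Proof.
move=> H.
have I0 : 0 <= (0 : R) <= 1 by apply/andP; split.
have I1 : 0 <= (1 : R) <= 1 by apply/andP; split.
pose g y := f (y + h *: v) - f y.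
have dg (s : R) : 0 <= s <= 1 -> is_derive (x + s *: (h *: u)) (h *: u) g
    (h * ('D_u f (x + (h * s) *: u + h *: v) - 'D_u f (x + (h * s) *: u))).
  move=> s01; have [+ _] := H s 1 s01 I1; have [+ _] := H s 0 s01 I0.
  rewrite mulr1 mulr0 scale0r addr0 scalerA [s * h]mulrC => df0 df1.
  have [df2 D2] := is_derive_translate df1.
  have [df3 D3] : is_derive (x + (h * s) *: u) u g
      ('D_u f (x + (h * s) *: u + h *: v) - 'D_u f (x + (h * s) *: u)).
    by split; [exact: derivableB df2 df0|rewrite (deriveB df2 df0) D2].
  by rewrite -D3; exact: is_derive_scale.
have [s s01 E] : exists2 s : R, 0 <= s <= 1 &
    g (x + h *: u) - g x = 'D_(h *: u) g (x + s *: (h *: u)).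
  by apply: MVT_line => s s01; have [D _] := dg s s01; exact: D.
have dd (t : R) : 0 <= t <= 1 ->
    is_derive (x + (h * s) *: u + t *: (h *: v)) (h *: v) ('D_u f)
      (h * 'D_v ('D_u f) (x + (h * s) *: u + (h * t) *: v)).
  move=> t01; have [_] := H s t s01 t01.
  by rewrite scalerA [t * h]mulrC => /(is_derive_scale h).
have [t t01 E'] := MVT_line (fun t t01 => let: DeriveDef D _ := dd t t01 in D).
exists s, t; split => //; move: E; have [_ ->] := dg s s01.
by rewrite E'; have [_ ->] := dd t t01.
Qed.

(** The second difference is symmetric in u and v, so the two mixed derivatives
    take a common value at two points arbitrarily close to x, and continuity
    concludes. *)
Lemma schwarz f x u v :
  (\forall y \near x, derivable f y u /\ derivable f y v) ->
  (\forall y \near x, derivable ('D_u f) y v /\ derivable ('D_v f) y u) ->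
  {for x, continuous ('D_v ('D_u f))} -> {for x, continuous ('D_u ('D_v f))} ->
  'D_v ('D_u f) x = 'D_u ('D_v f) x.
Proof.
move=> df ddf cvu cuv; apply/eqP; rewrite -subr_eq0 -normr_eq0.
apply/negPn/negP => neq.
set e := `|_| in neq.
have e0 : 0 < e / 2 by rewrite divr_gt0// lt_def neq /e normr_ge0.
have near_x : \forall y \near x,
  [/\ derivable f y u, derivable f y v, derivable ('D_u f) y v,
      derivable ('D_v f) y u & `|'D_v ('D_u f) x - 'D_v ('D_u f) y| < e / 2 /\
      `|'D_u ('D_v f) x - 'D_u ('D_v f) y| < e / 2].
  have c1 : \forall y \near x, `|'D_v ('D_u f) x - 'D_v ('D_u f) y| < e / 2.
    by move/cvgrPdist_lt: cvu; apply.
  have c2 : \forall y \near x, `|'D_u ('D_v f) x - 'D_u ('D_v f) y| < e / 2.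
    by move/cvgrPdist_lt: cuv; apply.
  apply: filterS (filterI (filterI df ddf) (filterI c1 c2)) => y /=.
  by move=> [[[? ?] [? ?]] [? ?]].
have near_uv := near_parallelogram u v near_x.
have near_vu := near_parallelogram v u near_x.
have [d /= d0 hd] := (nbhs_ballP (0 : R) _).1 (filterI near_uv near_vu).
(* Any nonzero h of norm less than d works. *)
pose h := d / 2; have h0 : h != 0 by rewrite gt_eqF// divr_gt0.
have hball : ball (0 : R) d h.
  rewrite -ball_normE /= sub0r normrN ger0_norm ?divr_ge0 ?ltW//.
  by rewrite ltr_pdivrMr// mulr_natr mulr2n ltrDl.
have [huv hvu] := hd h hball.
have [s [t [s01 t01 E1]]] := @second_difference f x u v h
  (fun s t s01 t01 => let: And5 a _ b _ _ := huv s t s01 t01 in conj a b).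
have [s' [t' [s'01 t'01 E2]]] := @second_difference f x v u h
  (fun s t s01 t01 => let: And5 _ a _ b _ := hvu s t s01 t01 in conj a b).
have [_ _ _ _ [L1 _]] := huv s t s01 t01.
have [_ _ _ _ [_ L2]] := hvu s' t' s'01 t'01.
have E : 'D_v ('D_u f) (x + (h * s) *: u + (h * t) *: v) =
         'D_u ('D_v f) (x + (h * s') *: v + (h * t') *: u).
  apply: (mulfI h0); apply: (mulfI h0).
  apply: etrans (esym E1) (etrans _ E2).
  by rewrite [x + h *: v + h *: u]addrAC; ring.
move: L2; rewrite -E distrC => L2.
have := ltrD L1 L2; rewrite -splitr ltNge => /negP; apply.
by apply: le_trans (ler_normD _ _); rewrite subrKA.
Qed.

End DirectionalDerivatives.

(** * Functions of class C^k on an open set *)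

Lemma colvec_sum_basis (R : realType) m (u : 'cV[R]_m) :
  u = \sum_(j < m) u j 0 *: basis_vec R j.
Proof.
rewrite {1}(matrix_sum_delta u); apply: eq_bigr => j _.
by rewrite big_ord1.
Qed.

Lemma near_eq_continuous (T T' : topologicalType) (f g : T -> T') (x : T) :
  (\forall y \near x, f y = g y) ->
  {for x, continuous f} -> {for x, continuous g}.
Proof.
move=> fg cf; rewrite /prop_for /continuous_at -(nbhs_singleton fg).
by apply: cvg_trans cf; exact: near_eq_cvg.
Qed.

Section SmoothFunctions.
Variables (R : realType) (m : nat) (O : set 'cV[R]_m).
Hypothesis openO : open O.
Implicit Types (f : 'cV[R]_m -> R) (x u v : 'cV[R]_m).

Lemma Ck_on_near_derivable (W : normedModType R) k (f : 'cV[R]_m -> W) x j :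
  Ck_on k.+1 O f -> O x -> \forall y \near x, derivable f y (basis_vec R j).
Proof.
move=> [_ /(_ j) [df _]] Ox.
by apply: filterS (open_nbhs_nbhs (conj openO Ox)) => y; exact: df.
Qed.

(** The definition of C^k speaks of the basis directions only; continuity of
    the partial derivatives is what makes the derivative linear in u. *)
Lemma Ck_on_is_derive k f x u : Ck_on k.+1 O f -> O x ->
  is_derive x u f (\sum_(j < m) u j 0 * 'D_(basis_vec R j) f x).
Proof.
move=> Cf Ox; rewrite [X in is_derive _ X](colvec_sum_basis u).
elim/big_rec2: _ => [|j a v _ dfv]; first exact: is_derive0.
rewrite [X in is_derive _ X]addrC [X in is_derive _ _ _ X]addrC.
apply: is_derive_dirD => //.
- exact: Ck_on_near_derivable Cf Ox.
- by case: Cf => _ /(_ j) [_]; case: k => [|k] [+ _]; apply.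
Qed.

Lemma Ck_on_is_derive2 f x u v : Ck_on 2 O f -> O x ->
  is_derive x v ('D_u f) (\sum_(i < m) \sum_(j < m)
    u i 0 * (v j 0 * 'D_(basis_vec R j) ('D_(basis_vec R i) f) x)).
Proof.
move=> Cf Ox.
have nearO : \forall y \near x, O y by exact: open_nbhs_nbhs (conj openO Ox).
have C1 j : Ck_on 1 O ('D_(basis_vec R j) f) by case: Cf => _ /(_ j) [].
apply: (@near_eq_is_derive _ _ _ (\sum_(i < m) u i 0 *: 'D_(basis_vec R i) f)).
  apply: filterS nearO => y Oy.
  by rewrite fct_sumE; have [_ ->] := Ck_on_is_derive u Cf Oy; apply: eq_bigr.
have dZ i : derivable (u i 0 *: 'D_(basis_vec R i) f) x v.
  by apply: derivableZ; have [] := Ck_on_is_derive v (C1 i) Ox.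
split; first exact: derivable_sum.
rewrite derive_sum//; apply: eq_bigr => i _.
have [d E] := Ck_on_is_derive v (C1 i) Ox.
by rewrite deriveZ// E -[LHS]/(_ * _) mulr_sumr.
Qed.

Lemma Ck_on_schwarz f x u v : Ck_on 2 O f -> O x ->
  'D_v ('D_u f) x = 'D_u ('D_v f) x.
Proof.
move=> Cf Ox.
have C1 j : Ck_on 1 O ('D_(basis_vec R j) f) by case: Cf => _ /(_ j) [].
have [_ ->] := Ck_on_is_derive2 u v Cf Ox.
have [_ ->] := Ck_on_is_derive2 v u Cf Ox.
rewrite exchange_big; apply: eq_bigr => i _; apply: eq_bigr => j _ /=.
suff -> : 'D_(basis_vec R i) ('D_(basis_vec R j) f) x =
          'D_(basis_vec R j) ('D_(basis_vec R i) f) x by exact: mulrCA.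
apply: schwarz.
- by apply: filterI; exact: Ck_on_near_derivable Cf Ox.
- by apply: filterI; exact: Ck_on_near_derivable (C1 _) Ox.
- by case: (C1 j) => _ /(_ i) [_] [+ _]; apply.
- by case: (C1 i) => _ /(_ j) [_] [+ _]; apply.
Qed.

Lemma Ck_on_ext (W : normedModType R) k (f g : 'cV[R]_m -> W) :
  (forall x, O x -> f x = g x) -> Ck_on k O f -> Ck_on k O g.
Proof.
move=> fg; have nearfg x : O x -> \forall y \near x, f y = g y.
  by move=> Ox; apply: filterS (open_nbhs_nbhs (conj openO Ox)) => y; exact: fg.
elim: k f g fg nearfg => [|k IH] f g fg nearfg [cf df].
  by split=> // x Ox; exact: near_eq_continuous (nearfg x Ox) (cf x Ox).
split=> [x Ox|j]; first exact: near_eq_continuous (nearfg x Ox) (cf x Ox).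
have [dfj Cfj] := df j; split.
  by move=> x Ox; apply: near_eq_derivable (nearfg x Ox) (dfj x Ox).
apply: IH Cfj => x Ox; first by apply: near_eq_derive; exact: nearfg.
apply: filterS (open_nbhs_nbhs (conj openO Ox)) => y Oy.
by apply: near_eq_derive; exact: nearfg.
Qed.

(** The partial derivatives of an entry agree with the entries of the partial
    derivatives on O only, hence the use of [Ck_on_ext]. *)
Lemma Ck_on_coord p q k (F : 'cV[R]_m -> 'M[R]_(p, q)) i j :
  Ck_on k O F -> Ck_on k O (fun x => F x i j : R).
Proof.
have coord0 (G : 'cV[R]_m -> 'M[R]_(p, q)) x : {for x, continuous G} ->
    {for x, continuous (fun y => G y i j : R)}.
  move=> cG; apply: (@continuous_comp _ _ _ G (fun N => N i j)) cG _.
  exact: coord_continuous.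
elim: k F => [|k IH] F [cF dF].
  by split=> // x Ox; apply: coord0; exact: cF.
split=> [x Ox|l]; first by apply: coord0; exact: cF.
have [dFl CFl] := dF l; split.
  by move=> x Ox; exact: (derivable_mxP _ _ _).1 (dFl x Ox) i j.
apply: Ck_on_ext (IH _ CFl) => x Ox.
by rewrite derive_mx ?mxE//; exact: dFl.
Qed.

End SmoothFunctions.

(** * Matrix-valued functions *)

Section MatrixDerivatives.
Variables (R : realType) (V : normedModType R).

Lemma is_derive_mxP p q (F : V -> 'M[R]_(p, q)) x v (D : 'M[R]_(p, q)) :
  is_derive x v F D <-> forall i j, is_derive x v (fun y => F y i j) (D i j).
Proof.
split=> [[dF <-] i j|H].
  split; first exact: (derivable_mxP _ _ _).1 dF i j.
  by rewrite derive_mx// mxE.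
have dF : derivable F x v by apply/derivable_mxP => i j; have [] := H i j.
split=> //; apply/matrixP => i j; rewrite derive_mx// mxE.
by have [] := H i j.
Qed.

Lemma is_derive_mulmx p q r (A : V -> 'M[R]_(p, q)) (B : V -> 'M[R]_(q, r)) x v
    (dA : 'M[R]_(p, q)) (dB : 'M[R]_(q, r)) :
  is_derive x v A dA -> is_derive x v B dB ->
  is_derive x v (fun y => A y *m B y) (dA *m B x + A x *m dB).
Proof.
move=> /is_derive_mxP HA /is_derive_mxP HB; apply/is_derive_mxP => i j.
rewrite !mxE -big_split /=.
rewrite (_ : (fun y => (A y *m B y) i j) =
  \sum_(k < q) ((fun y => A y i k) * (fun y => B y k j))); last first.
  by apply/funext => y; rewrite fct_sumE mxE.
apply: is_derive_sum => k; have D := is_deriveM (HA i k) (HB k j).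
apply: is_derive_eq D _.
by rewrite addrC [dA i k * _]mulrC.
Qed.

Lemma is_derive_trmx p q (A : V -> 'M[R]_(p, q)) x v (dA : 'M[R]_(p, q)) :
  is_derive x v A dA -> is_derive x v (fun y => (A y)^T) dA^T.
Proof.
move=> /is_derive_mxP H; apply/is_derive_mxP => i j; rewrite mxE.
rewrite (_ : (fun _ => _) = fun y => A y j i)//.
by apply/funext => y; rewrite mxE.
Qed.

Lemma is_derive_scalemx p q (c : V -> R) (A : V -> 'M[R]_(p, q)) x v dc
    (dA : 'M[R]_(p, q)) :
  is_derive x v c dc -> is_derive x v A dA ->
  is_derive x v (fun y => c y *: A y) (dc *: A x + c x *: dA).
Proof.
move=> Hc /is_derive_mxP H; apply/is_derive_mxP => i j; rewrite !mxE.
rewrite (_ : (fun y => (c y *: A y) i j) = c * (fun y => A y i j)); last first.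
  by apply/funext => y; rewrite mxE.
have D := is_deriveM Hc (H i j); apply: is_derive_eq D _.
by rewrite addrC [dc * _]mulrC.
Qed.

End MatrixDerivatives.

Section SmoothMatrices.
Variables (R : realType) (m : nat) (O : set 'cV[R]_m).
Hypothesis openO : open O.

Lemma Ck_on_mx_is_derive p q k (F : 'cV[R]_m -> 'M[R]_(p, q)) x v :
  Ck_on k.+1 O F -> O x -> is_derive x v F ('D_v F x).
Proof.
move=> CF Ox; split=> //; apply/derivable_mxP => i j.
by have [] := Ck_on_is_derive openO v (Ck_on_coord openO i j CF) Ox.
Qed.

Lemma Ck_on_mx_schwarz p q (F : 'cV[R]_m -> 'M[R]_(p, q)) x u v :
  Ck_on 2 O F -> O x -> 'D_v ('D_u F) x = 'D_u ('D_v F) x.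
Proof.
move=> CF Ox.
have E a b : 'D_b ('D_a F) x =
    \matrix_(i, j) 'D_b ('D_a (fun y => F y i j)) x.
  have nearE : \forall y \near x,
      'D_a F y = \matrix_(i, j) 'D_a (fun y => F y i j) y.
    apply: filterS (open_nbhs_nbhs (conj openO Ox)) => y Oy.
    by rewrite derive_mx//; have [] := Ck_on_mx_is_derive a CF Oy.
  rewrite (near_eq_derive b nearE) derive_mx.
    apply/matrixP => i j; rewrite !mxE; congr ('D_b _ x).
    by apply/funext => y; rewrite mxE.
  apply/derivable_mxP => i j.
  rewrite (_ : (fun _ => _) = 'D_a (fun y => F y i j)).
    by have [] := Ck_on_is_derive2 openO a b (Ck_on_coord openO i j CF) Ox.
  by apply/funext => y; rewrite mxE.
apply: etrans (E u v) (etrans _ (esym (E v u))).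
apply: eq_mx => i j.
have S := Ck_on_schwarz openO u v (Ck_on_coord openO i j CF) Ox.
exact: S.
Qed.

End SmoothMatrices.

(** * Algebraic curvature tensors with two anticommuting symmetries *)

Section CurvatureLikeTensors.
Variables (F : realFieldType) (T : Type) (A : T -> T -> T -> T -> F).
Hypothesis anti12 : forall x y z w, A x y z w = - A y x z w.
Hypothesis anti34 : forall x y z w, A x y z w = - A x y w z.
Hypothesis bianchi : forall x y z w, A x y z w + A y z x w + A z x y w = 0.

(** The cyclic identities for (x, y, z, w) and its cyclic shifts, taken with
    signs +, +, -, -, add up to twice the difference of the two sides. *)
Lemma curvature_pair_sym x y z w : A x y z w = A z w x y.
Proof.
have := bianchi x y z w; have := bianchi y z w x.
have := bianchi z w x y; have := bianchi w x y z.
rewrite (anti34 y z w x) (anti34 z w y x) (anti34 w x z y) (anti34 x y w z).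
rewrite (anti12 y w x z) (anti34 w y x z) (anti12 x z w y) (anti34 z x w y).
lra.
Qed.

(** The defect D is antisymmetric in its first two arguments, and the cyclic
    identities for (J x, y, z) and for (x, y, z) with J in the last slot make it
    symmetric in the second and third; such a function vanishes. *)
Lemma pure_of_symmetric (J : T -> T) :
  (forall x y z w, A x y (J z) w = A x y z (J w)) ->
  forall x y z w, A (J x) y z w = A x y (J z) w.
Proof.
move=> symJ.
have J12 x y z w : A (J x) y z w = A x (J y) z w.
  by rewrite curvature_pair_sym symJ -curvature_pair_sym.
pose D x y z w := A (J x) y z w - A x y (J z) w.
have D12 x y z w : D x y z w = - D y x z w.
  by rewrite /D J12 (anti12 x (J y)) (anti12 x y) opprD !opprK.
have D23 x y z w : D x y z w = D x z y w.
  rewrite /D.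
  have := bianchi (J x) y z w; have := bianchi x y z (J w).
  rewrite -!symJ (anti12 z (J x)) (anti12 z x).
  lra.
move=> x y z w; apply/eqP; rewrite -subr_eq0 -/(D x y z w).
have E : D x y z w = - D x y z w.
  by rewrite {1}D12 D23 D12 D23 D12 D23 !opprK.
lra.
Qed.

(** Moving J and L one at a time from slot 1 to slot 3 reverses their order, so
    J L picks up a sign there.  Combined with antisymmetry in the first pair,
    J L can be moved from slot 1 to slot 2 without a sign; but J L is skew on
    the last pair, hence by pair symmetry also on the first, and moves with a
    sign. *)
Lemma curvature_like_eq0 (J L : T -> T) :
  (forall x y z w, A x y (J z) w = A x y z (J w)) ->
  (forall x y z w, A x y (L z) w = A x y z (L w)) ->
  (forall x y z w, A x y (L (J z)) w = - A x y (J (L z)) w) ->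
  (forall y, exists y', J (L y') = y) ->
  forall x y z w, A x y z w = 0.
Proof.
move=> symJ symL anti surj.
have JL13 x y z w : A (J (L x)) y z w = - A x y (J (L z)) w.
  by rewrite !pure_of_symmetric.
have JL12 x y z w : A (J (L x)) y z w = A x (J (L y)) z w.
  by rewrite JL13 (anti12 x y) opprK (anti12 x (J _)) JL13 opprK.
have JL34 x y z w : A x y (J (L z)) w = - A x y z (J (L w)).
  by rewrite symJ symL (anti34 x y z (L _)) anti opprK (anti34 x y _ z).
move=> x y z w; have [y' <-] := surj y.
have := JL12 x y' z w; rewrite curvature_pair_sym JL34 -curvature_pair_sym.
lra.
Qed.

End CurvatureLikeTensors.

(** * Curvature commuting with a pseudo-hyperkaehler structure *)

Section BilinearForms.
Variables (R : realType) (m : nat).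
Implicit Types (A B G J L K : 'M[R]_m) (u v w : 'cV[R]_m).

Lemma ev_bil_inj A B : (forall v w, ev_bil A v w = ev_bil B v w) -> A = B.
Proof.
move=> AB; apply/matrixP => i j.
have := AB (delta_mx i 0) (delta_mx j 0).
by rewrite /ev_bil !trmx_delta -!rowE -!colE !mxE.
Qed.

Lemma mulmx_cV_inj p (A B : 'M[R]_(p, m)) :
  (forall w : 'cV[R]_m, A *m w = B *m w) -> A = B.
Proof.
move=> AB; apply/matrixP => i j.
by have /colP/(_ i) := AB (delta_mx j 0); rewrite -!colE !mxE.
Qed.

Lemma ev_bil_mull A B u v : ev_bil A (B *m u) v = ev_bil (B^T *m A) u v.
Proof. by rewrite /ev_bil trmx_mul !mulmxA. Qed.

Lemma ev_bil_mulr A B u v : ev_bil A u (B *m v) = ev_bil (A *m B) u v.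
Proof. by rewrite /ev_bil !mulmxA. Qed.

Lemma ev_bil_tr A u v : ev_bil A u v = ev_bil A^T v u.
Proof.
have E : v^T *m A^T *m u = (u^T *m A *m v)^T.
  by rewrite !trmx_mul trmxK mulmxA.
by rewrite /ev_bil E [RHS]mxE.
Qed.

Lemma ev_bilN A u v : ev_bil (- A) u v = - ev_bil A u v.
Proof. by rewrite /ev_bil mulmxN mulNmx mxE. Qed.

Lemma ev_bil_mulNl A u v : ev_bil A (- u) v = - ev_bil A u v.
Proof. by rewrite /ev_bil linearN /= !mulNmx mxE. Qed.

Lemma ev_bilDl A u v w : ev_bil A (u + v) w = ev_bil A u w + ev_bil A v w.
Proof. by rewrite /ev_bil linearD !mulmxDl mxE. Qed.

(** Metric form of [curvature_like_eq0]: an endomorphism that is self-adjoint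
    and commutes with the curvature can be exchanged between the last two slots
    of G(K(x, y) z, w). *)
Lemma pseudo_hyperkahler_curvature_eq0 G J L
    (K : 'cV[R]_m -> 'cV[R]_m -> 'M[R]_m) :
  G^T = G -> G \in unitmx ->
  J^T *m G = G *m J -> L^T *m G = G *m L ->
  L *m J = - (J *m L) -> (J *m L) *m (J *m L) = - 1%:M ->
  (forall u v, K u v = - K v u) ->
  (forall u v w, K u v *m w + K v w *m u + K w u *m v = 0) ->
  (forall u v, (K u v)^T *m G + G *m K u v = 0) ->
  (forall u v, J *m K u v = K u v *m J) ->
  (forall u v, L *m K u v = K u v *m L) ->
  forall u v, K u v = 0.
Proof.
move=> symG unitG symJ symL LJ JL2 antiK bianchiK skewK KJ KL u v.
pose A x y z w := ev_bil G (K x y *m z) w.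
have symA S (symS : S^T *m G = G *m S)
    (KS : forall x y, S *m K x y = K x y *m S) x y z w :
    A x y (S *m z) w = A x y z (S *m w).
  by rewrite /A mulmxA -KS -mulmxA ev_bil_mull symS ev_bil_mulr.
have AE x y z w : A x y z w = ev_bil ((K x y)^T *m G) z w.
  by rewrite /A ev_bil_mull.
have A0 : forall x y z w, A x y z w = 0.
  apply: (@curvature_like_eq0 _ _ A _ _ _ (mulmx J) (mulmx L)).
  - by move=> x y z w; rewrite !AE (antiK x) linearN /= mulNmx ev_bilN.
  - move=> x y z w.
    have skew : (K x y)^T *m G = - (G *m K x y).
      by apply/eqP; rewrite -addr_eq0 skewK.
    by rewrite !AE [in RHS]skew ev_bilN opprK [RHS]ev_bil_tr trmx_mul symG.
  - move=> x y z w; rewrite /A -!ev_bilDl bianchiK.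
    by rewrite /ev_bil trmx0 !mul0mx mxE.
  - exact: symA.
  - exact: symA.
  - move=> x y z w; rewrite (mulmxA L J) LJ (mulmxA J L).
    by rewrite /A mulNmx mulmxN ev_bil_mulNl.
  - move=> y; exists (- (J *m L *m y)).
    by rewrite (mulmxA J L) mulmxN mulmxA JL2 mulNmx mul1mx opprK.
apply: mulmx_cV_inj => z; rewrite mul0mx.
have GK : G *m (K u v *m z) = 0.
  apply/trmx_inj; apply: mulmx_cV_inj => w; apply/matrixP => i j.
  rewrite !ord1 trmx0 mul0mx [RHS]mxE -(A0 u v z w) /A /ev_bil trmx_mul symG.
  by [].
by rewrite -[LHS]mul1mx -(mulVmx unitG) -mulmxA GK mulmx0.
Qed.

End BilinearForms.

(** * Commutator identities at a point *)

Section MatrixIdentities.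
Variables (R : realType) (m : nat).

(** With a, b, c the connection matrices in the directions u, v, w and duv the
    derivative along u of the one in the direction v: each summand is a
    curvature endomorphism, and the hypotheses are the symmetry of the
    connection and of its derivatives. *)
Lemma bianchi_mx (a b c duv dvu dvw dwv dwu duw : 'M[R]_m) (u v w : 'cV[R]_m) :
  a *m v = b *m u -> b *m w = c *m v -> c *m u = a *m w ->
  duv *m w = duw *m v -> dvw *m u = dvu *m w -> dwu *m v = dwv *m u ->
  (duv - dvu + (a *m b - b *m a)) *m w + (dvw - dwv + (b *m c - c *m b)) *m u
  + (dwu - duw + (c *m a - a *m c)) *m v = 0.
Proof.
move=> ab bc ca du dv dw.
rewrite !mulmxDl !mulNmx -!mulmxA ab bc ca du dv dw.
move: (a *m (c *m v)) (b *m (a *m w)) (c *m (b *m u)) (duw *m v) (dvu *m w).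
move: (dwv *m u).
move=> e1 e2 e3 e4 e5 e6.
by apply/matrixP => i j; rewrite !mxE; ring.
Qed.

(** With a, b the connection matrices in the directions u, v, and p, q the
    derivatives of a along v and of b along u, the matrix q - p + (a b - b a)
    is the curvature endomorphism.  The last hypothesis equates the two second
    derivatives of G. *)
Lemma parallel_form_commutator (a b p q G dGa dGb : 'M[R]_m) :
  dGa = a^T *m G + G *m a -> dGb = b^T *m G + G *m b ->
  p^T *m G + a^T *m dGb + (dGb *m a + G *m p) =
    q^T *m G + b^T *m dGa + (dGa *m b + G *m q) ->
  (q - p + (a *m b - b *m a))^T *m G + G *m (q - p + (a *m b - b *m a)) = 0.
Proof.
move=> -> ->.
have -> : (q - p + (a *m b - b *m a))^T =
    q^T - p^T + (b^T *m a^T - a^T *m b^T).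
  by rewrite -!trmx_mul; apply/matrixP => i j; rewrite !mxE.
rewrite !(mulmxDl, mulmxDr, mulNmx, mulmxN).
rewrite !mulmxA => E; apply/matrixP => i j; move/matrixP/(_ i j): E.
move: (p^T *m G) (q^T *m G) (G *m p) (G *m q).
move: (a^T *m b^T *m G) (b^T *m a^T *m G) (G *m a *m b) (G *m b *m a).
move: (a^T *m G *m b) (b^T *m G *m a) => e1 e2 e3 e4 e5 e6 e7 e8 e9 e10.
by rewrite !mxE; lra.
Qed.

(** Here a, b, p, q are as in [parallel_form_commutator], and the last
    hypothesis equates the two second derivatives of A. *)
Lemma rotated_pair_commutator (a b p q A B dAa dAb dBa dBb : 'M[R]_m)
    (r s oa ob da db : R) :
  dAa = (r * oa) *: B + (A *m a - a *m A) ->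
  dAb = (r * ob) *: B + (A *m b - b *m A) ->
  dBa = (s * oa) *: A + (B *m a - a *m B) ->
  dBb = (s * ob) *: A + (B *m b - b *m B) ->
  (r * da) *: B + (r * oa) *: dBb
    + (dAb *m a + A *m p - (p *m A + a *m dAb)) =
    (r * db) *: B + (r * ob) *: dBa
    + (dAa *m b + A *m q - (q *m A + b *m dAa)) ->
  (q - p + (a *m b - b *m a)) *m A - A *m (q - p + (a *m b - b *m a)) =
    (r * (db - da)) *: B.
Proof.
move=> -> -> -> ->.
rewrite !(mulmxDl, mulmxDr, mulNmx, mulmxN).
rewrite !(scalerDr, scalerDl, scalerN, scaleNr).
rewrite -!(scalemxAl, scalemxAr) !mulmxA => E.
apply/matrixP => i j; move/matrixP/(_ i j): E.
move: (A *m p) (A *m q) (p *m A) (q *m A) (A *m a *m b).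
move: (A *m b *m a) (a *m b *m A) (b *m a *m A) (a *m A *m b).
move: (b *m A *m a) (B *m a) (B *m b) (a *m B) (b *m B).
move=> e1 e2 e3 e4 e5 e6 e7 e8 e9 e10 e11 e12 e13 e14.
by rewrite !mxE; lra.
Qed.

Lemma selfadjoint_commutator (a G A dG dA : 'M[R]_m) :
  dG = a^T *m G + G *m a -> A^T *m G = G *m A ->
  dA^T *m G + A^T *m dG = dG *m A + G *m dA ->
  (dA + a *m A - A *m a)^T *m G = G *m (dA + a *m A - A *m a).
Proof.
move=> -> self.
have -> : (dA + a *m A - A *m a)^T = dA^T + A^T *m a^T - a^T *m A^T.
  by rewrite -!trmx_mul; apply/matrixP => i j; rewrite !mxE.
have aGA : a^T *m G *m A = a^T *m A^T *m G by rewrite -!mulmxA self.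
rewrite !(mulmxDl, mulmxDr, mulNmx, mulmxN) !mulmxA aGA -self => E.
apply/matrixP => i j; move/matrixP/(_ i j): E.
move: (dA^T *m G) (G *m dA) (A^T *m a^T *m G) (A^T *m G *m a) (G *m a *m A).
move: (a^T *m A^T *m G) => e1 e2 e3 e4 e5 e6.
by rewrite !mxE; lra.
Qed.

End MatrixIdentities.

(** * Curvature of a connection in coordinates *)

(** The endomorphism R(u, v) in the chart, dA + A /\ A for the connection
    matrix A; it is the operator behind [curvature] by [curvatureE]. *)
Definition curv_mx (R : realType) (m : nat) (Gam : 'cV[R]_m -> 'I_m -> 'M[R]_m)
    (x u v : 'cV[R]_m) : 'M[R]_m :=
  'D_u (fun y => conn_mx (Gam y) v) x - 'D_v (fun y => conn_mx (Gam y) u) x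
  + (conn_mx (Gam x) u *m conn_mx (Gam x) v
     - conn_mx (Gam x) v *m conn_mx (Gam x) u).

Section Connection.
Variables (R : realType) (m : nat) (O : set 'cV[R]_m).
Variable Gam : 'cV[R]_m -> 'I_m -> 'M[R]_m.
Hypothesis openO : open O.
Hypothesis smoothGam : forall i, smooth_on O (fun x => Gam x i).
Implicit Types (x u v w : 'cV[R]_m).

Local Notation Gm u := (fun y => conn_mx (Gam y) u).

Lemma conn_is_derive x u v : O x -> is_derive x v (Gm u) ('D_v (Gm u) x).
Proof.
move=> Ox; split=> //.
rewrite (_ : Gm u = \sum_(i < m) (u i 0 *: (fun y => Gam y i))).
  apply: derivable_sum => i; apply: derivableZ.
  by have [] := Ck_on_mx_is_derive openO v (@smoothGam i 1) Ox.
by apply/funext => y; rewrite fct_sumE.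
Qed.

Lemma cov_cst x u v : cov Gam (cst u) (cst v) x = conn_mx (Gam x) u *m v.
Proof. by rewrite /cov derive_cst add0r. Qed.

Lemma lie_cst u v : lie (cst u) (cst v) = cst 0.
Proof. by apply/funext => x; rewrite /lie !derive_cst subrr. Qed.

Lemma is_derive_mulmx_cst p q (A : 'cV[R]_m -> 'M[R]_(p, q)) x v
    (w : 'cV[R]_q) (dA : 'M[R]_(p, q)) :
  is_derive x v A dA -> is_derive x v (fun y => A y *m w) (dA *m w).
Proof.
move=> HA; apply: is_derive_eq.
  exact: is_derive_mulmx HA (is_derive_cst _ _ _).
by rewrite mulmx0 addr0.
Qed.

Lemma curvatureE x u v w : O x ->
  curvature Gam x u v w = curv_mx Gam x u v *m w.
Proof.
move=> Ox; rewrite /curvature lie_cst.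
have E a : cov Gam (cst a) (cst w) = fun y => conn_mx (Gam y) a *m w.
  by apply/funext => y; exact: cov_cst.
have -> : cov Gam (cst 0) (cst w) x = 0.
  rewrite cov_cst /conn_mx big1 ?mul0mx// => i _.
  by rewrite mxE scale0r.
rewrite subr0 !E /cov.
have [_ ->] := is_derive_mulmx_cst w (conn_is_derive v u Ox).
have [_ ->] := is_derive_mulmx_cst w (conn_is_derive u v Ox).
by rewrite /curv_mx !mulmxDl !mulNmx !mulmxA opprD addrACA.
Qed.

Lemma torsion_free_sym x u v : torsion Gam x u v = 0 ->
  conn_mx (Gam x) u *m v = conn_mx (Gam x) v *m u.
Proof.
by rewrite /torsion lie_cst !cov_cst subr0 => /eqP; rewrite subr_eq0 => /eqP.
Qed.

Lemma curv_mx_anti x u v : curv_mx Gam x u v = - curv_mx Gam x v u.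
Proof. by rewrite /curv_mx opprD !opprB. Qed.

(** First Bianchi identity: torsion-freeness says that Gamma(u, v) is symmetric
    on the whole open set, so its derivatives are symmetric too. *)
Lemma curv_mx_bianchi x u v w : O x ->
  (forall y, O y -> forall u v, torsion Gam y u v = 0) ->
  curv_mx Gam x u v *m w + curv_mx Gam x v w *m u + curv_mx Gam x w u *m v = 0.
Proof.
move=> Ox tf.
have G0 a b : conn_mx (Gam x) a *m b = conn_mx (Gam x) b *m a.
  by apply: torsion_free_sym; exact: tf.
have G1 c a b : 'D_c (Gm a) x *m b = 'D_c (Gm b) x *m a.
  have [_ <-] := is_derive_mulmx_cst b (conn_is_derive a c Ox).
  have [_ <-] := is_derive_mulmx_cst a (conn_is_derive b c Ox).
  apply: near_eq_derive.
  apply: filterS (open_nbhs_nbhs (conj openO Ox)) => y Oy.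
  by apply: torsion_free_sym; exact: tf.
exact: bianchi_mx (G0 u v) (G0 v w) (G0 w u) (G1 u v w) (G1 v w u) (G1 w u v).
Qed.

Lemma parallel_form_derive (G : 'cV[R]_m -> 'M[R]_m) x u :
  O x -> smooth_on O G ->
  (forall y, O y -> forall u v w, nabla_bilinear Gam G y u v w = 0) ->
  'D_u G x = (conn_mx (Gam x) u)^T *m G x + G x *m conn_mx (Gam x) u.
Proof.
move=> Ox smG parG; apply: ev_bil_inj => b c.
have := parG x Ox u b c; rewrite /nabla_bilinear !cov_cst.
have HG := Ck_on_mx_is_derive openO u (smG 1) Ox.
have HGc := is_derive_mulmx (is_derive_cst b^T x u) HG.
have /is_derive_mxP/(_ 0 0) [_ D] := is_derive_mulmx_cst c HGc.
rewrite /ev_bil D mul0mx add0r.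
rewrite -/(ev_bil _ _ _) -/(ev_bil _ _ _) -/(ev_bil _ _ _).
rewrite ev_bil_mull ev_bil_mulr => /eqP.
rewrite -addrA -opprD subr_eq0 => /eqP ->.
by rewrite /ev_bil mulmxDr mulmxDl [RHS]mxE.
Qed.

(** Ricci identity for a parallel form: the parallelism equation is
    differentiated once more, and the two orders of differentiation agree. *)
Lemma curv_mx_skew (G : 'cV[R]_m -> 'M[R]_m) x u v : O x -> smooth_on O G ->
  (forall y, O y -> forall u v w, nabla_bilinear Gam G y u v w = 0) ->
  (curv_mx Gam x u v)^T *m G x + G x *m curv_mx Gam x u v = 0.
Proof.
move=> Ox smG parG.
have DG a y (Oy : O y) := parallel_form_derive a Oy smG parG.
have DDG a b : 'D_b ('D_a G) x =
    ('D_b (Gm a) x)^T *m G x + (conn_mx (Gam x) a)^T *m 'D_b G x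
    + ('D_b G x *m conn_mx (Gam x) a + G x *m 'D_b (Gm a) x).
  have -> : 'D_b ('D_a G) x = 'D_b ((fun y => (conn_mx (Gam y) a)^T *m G y)
      + (fun y => G y *m conn_mx (Gam y) a)) x.
    apply: near_eq_derive.
    apply: filterS (open_nbhs_nbhs (conj openO Ox)) => y Oy.
    exact: DG.
  have HG := Ck_on_mx_is_derive openO b (smG 1) Ox.
  have HA := conn_is_derive a b Ox.
  have H1 := is_derive_mulmx (is_derive_trmx HA) HG.
  have H2 := is_derive_mulmx HG HA.
  by have [_] := is_deriveD H1 H2.
apply: parallel_form_commutator (DG u x Ox) (DG v x Ox) _.
apply: etrans (esym (DDG u v)) (etrans _ (DDG v u)).
have S := Ck_on_mx_schwarz openO u v (smG 2) Ox; exact: S.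
Qed.

Lemma nabla_endoE (A : 'cV[R]_m -> 'M[R]_m) x u v : O x -> smooth_on O A ->
  nabla_endo Gam A x u v =
    ('D_u A x + conn_mx (Gam x) u *m A x - A x *m conn_mx (Gam x) u) *m v.
Proof.
move=> Ox smA; rewrite /nabla_endo cov_cst /cov.
have HA := Ck_on_mx_is_derive openO u (smA 1) Ox.
have [_ ->] := is_derive_mulmx_cst v HA.
by rewrite !mulmxDl mulNmx !mulmxA.
Qed.

(** Ricci identity for two endomorphism fields that the connection maps into
    each other.  The two constants r and s make the lemma applicable to (A, B)
    and to (B, A); the quadratic terms in omega, of the form
    r s (omega(u) omega(v) - omega(v) omega(u)), cancel. *)
Lemma curv_mx_rotation (omega : 'cV[R]_m -> 'rV[R]_m) (r s : R)
    (A B : 'cV[R]_m -> 'M[R]_m) x u v :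
  O x -> smooth_on O A -> smooth_on O B -> smooth_on O omega ->
  (forall y, O y -> forall u v, nabla_endo Gam A y u v =
     (r * ev_form (omega y) u) *: (B y *m v)) ->
  (forall y, O y -> forall u v, nabla_endo Gam B y u v =
     (s * ev_form (omega y) u) *: (A y *m v)) ->
  curv_mx Gam x u v *m A x - A x *m curv_mx Gam x u v =
    (r * ('D_u (fun y => ev_form (omega y) v : R) x
          - 'D_v (fun y => ev_form (omega y) u : R) x)) *: B x.
Proof.
move=> Ox smA smB smo nA nB.
have DE (C E : 'cV[R]_m -> 'M[R]_m) (k : R) :
    smooth_on O C ->
    (forall y, O y -> forall u v, nabla_endo Gam C y u v =
      (k * ev_form (omega y) u) *: (E y *m v)) ->
    forall a y, O y -> 'D_a C y = (k * ev_form (omega y) a) *: E y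
      + (C y *m conn_mx (Gam y) a - conn_mx (Gam y) a *m C y).
  move=> smC nC a y Oy; apply: mulmx_cV_inj => w; have := nC y Oy a w.
  rewrite nabla_endoE// !mulmxDl !mulNmx -scalemxAl => <-.
  by rewrite addrA subrK addrK.
have DA := DE A B r smA nA; have DB := DE B A s smB nB.
pose om a := (fun y => ev_form (omega y) a : R).
have DDA a b : 'D_b ('D_a A) x =
    (r * 'D_b (om a) x) *: B x + (r * om a x) *: 'D_b B x
    + ('D_b A x *m conn_mx (Gam x) a + A x *m 'D_b (Gm a) x
       - ('D_b (Gm a) x *m A x + conn_mx (Gam x) a *m 'D_b A x)).
  have -> : 'D_b ('D_a A) x = 'D_b ((fun y => (r * om a y) *: B y)
      + ((fun y => A y *m conn_mx (Gam y) a)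
         - (fun y => conn_mx (Gam y) a *m A y))) x.
    apply: near_eq_derive.
    apply: filterS (open_nbhs_nbhs (conj openO Ox)) => y Oy.
    exact: DA.
  have HA := Ck_on_mx_is_derive openO b (smA 1) Ox.
  have HB := Ck_on_mx_is_derive openO b (smB 1) Ox.
  have Ho := Ck_on_mx_is_derive openO b (smo 1) Ox.
  have /is_derive_mxP/(_ 0 0) [Dom _] := is_derive_mulmx_cst a Ho.
  have Hom : is_derive x b (fun y => r * om a y) (r * 'D_b (om a) x).
    have Hom : is_derive x b (om a) ('D_b (om a) x) by split.
    exact: is_deriveZ Hom.
  have HG := conn_is_derive a b Ox.
  have H1 := is_derive_scalemx Hom HB.
  have H2 := is_deriveB (is_derive_mulmx HA HG) (is_derive_mulmx HG HA).
  by have [_] := is_deriveD H1 H2.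
apply: rotated_pair_commutator
  (DA u x Ox) (DA v x Ox) (DB u x Ox) (DB v x Ox) _.
apply: etrans (esym (DDA u v)) (etrans _ (DDA v u)).
have S := Ck_on_mx_schwarz openO u v (smA 2) Ox; exact: S.
Qed.

(** The equation A^T G = G A is differentiated, and the derivative of G is
    replaced using that G is parallel. *)
Lemma nabla_endo_selfadjoint (G A : 'cV[R]_m -> 'M[R]_m) (N : 'M[R]_m) x u :
  O x -> smooth_on O G -> smooth_on O A ->
  (forall y, O y -> forall u v w, nabla_bilinear Gam G y u v w = 0) ->
  (forall y, O y -> (A y)^T *m G y = G y *m A y) ->
  (forall v, nabla_endo Gam A x u v = N *m v) ->
  N^T *m G x = G x *m N.
Proof.
move=> Ox smG smA parG selfA nA.
have -> : N = 'D_u A x + conn_mx (Gam x) u *m A x - A x *m conn_mx (Gam x) u.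
  by apply: mulmx_cV_inj => w; rewrite -nabla_endoE.
have HG := Ck_on_mx_is_derive openO u (smG 1) Ox.
have HA := Ck_on_mx_is_derive openO u (smA 1) Ox.
have [_ D1] := is_derive_mulmx (is_derive_trmx HA) HG.
have [_ D2] := is_derive_mulmx HG HA.
apply: selfadjoint_commutator (parallel_form_derive u Ox smG parG) _ _.
  exact: selfA.
apply: etrans (esym D1) (etrans _ D2).
apply: near_eq_derive; apply: filterS (open_nbhs_nbhs (conj openO Ox)) => y Oy.
exact: selfA.
Qed.

(** The Christoffel terms cancel by torsion-freeness. *)
Lemma ext_dE (omega : 'cV[R]_m -> 'rV[R]_m) x u v : torsion Gam x u v = 0 ->
  ext_d Gam omega x u v = 'D_u (fun y => ev_form (omega y) v : R) x
                        - 'D_v (fun y => ev_form (omega y) u : R) x.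
Proof.
move=> tf; rewrite /ext_d /nabla_form !cov_cst (torsion_free_sym tf).
by rewrite opprB addrA subrK.
Qed.

End Connection.

(** * Charts *)

Section ManifoldCharts.
Variables (R : realType) (m : nat) (M : smooth_manifold R m).

(** On the image of the chart, [in_chart c A] is the preimage of A under the
    continuous inverse of the chart. *)
Lemma in_chart_open (c : chart M) (A : set M) : open A -> open (in_chart c A).
Proof.
move=> oA; rewrite openE => x [p [dp Ap] <-].
have cx : (Defs.coord c @` dom c) (Defs.coord c p) by exists p.
have n1 : nbhs (Defs.coord c p) (Defs.coord c @` dom c).
  by apply: open_nbhs_nbhs; split; [exact: codom_open|exact: cx].
have n2 : nbhs (Defs.coord c p) (Defs.point c @^-1` (dom c `&` A)).
  apply: (Defs.point_continuous cx); rewrite coordK//.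
  by apply: open_nbhs_nbhs; split=> //; apply: openI => //; exact: dom_open.
apply: filterS (filterI n1 n2) => y [[q dq <-]] /=; rewrite coordK// => Dq.
by exists q.
Qed.

Lemma in_chart_subset (c : chart M) (A : set M) :
  in_chart c A `<=` in_chart c setT.
Proof. by move=> x [p [dp _] <-]; exists p. Qed.

Lemma smooth_on_subset (W : normedModType R) (O O' : set 'cV[R]_m)
    (f : 'cV[R]_m -> W) : O `<=` O' -> smooth_on O' f -> smooth_on O f.
Proof.
move=> OO' smf k; elim: k f {smf} (smf k) => [|k IH] f [cf df].
  by split=> // x /OO' /cf.
split=> [x /OO' /cf //|j]; have [dfj Cfj] := df j.
by split=> [x /OO' /dfj //|]; exact: IH.
Qed.

End ManifoldCharts.

(** * Invertible matrices *)

Section UnitMatrices.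
Variables (R : realType) (m : nat).

(** The index i excludes dimension 0, where the zero matrix is invertible. *)
Lemma scalemx_unit_eq0 (i : 'I_m) (c : R) (M : 'M[R]_m) :
  M \in unitmx -> c *: M = 0 -> c = 0.
Proof.
move=> uM cM; have : c *: (1%:M : 'M[R]_m) = 0.
  by rewrite -(mulmxV uM) scalemxAl cM mul0mx.
by move/matrixP/(_ i i); rewrite !mxE eqxx mulr1.
Qed.

Lemma has_signature_unit p (B : 'M[R]_m) :
  has_signature p B -> B \in unitmx.
Proof.
case=> P uP E; have : P^T *m B *m P \in unitmx.
  rewrite E unitmxE det_diag unitfE; apply/prodf_neq0 => i _.
  by rewrite mxE; case: ifP; rewrite ?oppr_eq0 oner_eq0.
by rewrite !unitmx_mul => /andP[/andP[]].
Qed.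

Lemma sqr_oppr1_unit (J : 'M[R]_m) : J *m J = - 1%:M -> J \in unitmx.
Proof.
move=> JJ; have : J *m - J = 1%:M by rewrite mulmxN JJ opprK.
by case/mulmx1_unit.
Qed.

End UnitMatrices.

(** * Quaternionic Kaehler NH-manifolds *)

Lemma ordS_i3 : ordS i3 = i1.
Proof. exact: val_inj. Qed.

Section QuaternionicKaehlerNH.
Variables (R : realType) (n : nat) (M : smooth_manifold R (4 * n)).
Variables (J : 'I_3 -> endo_field M) (g : bilinear_field M).
Variables (gJ : 'I_3 -> bilinear_field M) (nabla : affine_connection M).
Variables (I : Type) (U : I -> set M).
Variable omega : forall i : I, 'I_3 -> one_form (U i).
Hypothesis hypJ : almost_hypercomplex J.
Hypothesis NHg : NH_metric_structure J g gJ.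
Hypothesis LC : levi_civita g nabla.
Hypothesis QK : quaternionic_kahler J nabla omega.
Hypothesis n_gt0 : (0 < n)%N.

Variables (i : I) (c : chart M).
Let O := in_chart c (U i).
Let openO : open O.
Proof. by apply: in_chart_open; case: QK. Qed.

Let sub := @in_chart_subset R (4 * n) M c (U i).
Let smJ a : smooth_on O (J a c) := smooth_on_subset sub (endo_smooth (J a) c).
Let smg : smooth_on O (g c) := smooth_on_subset sub (bilinear_smooth g c).
Let smw a : smooth_on O (omega i a c) := form_smooth (omega i a) c.
Let smG k : smooth_on O (fun x => nabla c x k) :=
  smooth_on_subset sub (christoffel_smooth nabla c k).

Let tf y (Oy : O y) u v : torsion (nabla c) y u v = 0.
Proof. by have [] := LC (sub Oy). Qed.

Let parg y (Oy : O y) u v w : nabla_bilinear (nabla c) (g c) y u v w = 0.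
Proof. by have [] := LC (sub Oy). Qed.

Let adjJ y (Oy : O y) a :
  (J a c y)^T *m g c y = - eps R a *: (g c y *m J a c y).
Proof.
apply: ev_bil_inj => u v; have [_ /(_ _ _ (sub Oy) a u v) [_ E1 E2]] := NHg.
rewrite -ev_bil_mull -E1 E2 ev_bil_mulr.
by rewrite /ev_bil -scalemxAr -scalemxAl [RHS]mxE.
Qed.

Let adj2 y (Oy : O y) : (J i2 c y)^T *m g c y = g c y *m J i2 c y.
Proof. by rewrite adjJ// /eps /= opprK scale1r. Qed.

Let adj3 y (Oy : O y) : (J i3 c y)^T *m g c y = g c y *m J i3 c y.
Proof. by rewrite adjJ// /eps /= opprK scale1r. Qed.

Let adj1 y (Oy : O y) : (J i1 c y)^T *m g c y = - (g c y *m J i1 c y).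
Proof. by rewrite adjJ// /eps /= scaleNr scale1r. Qed.

Let g_sym y (Oy : O y) : (g c y)^T = g c y.
Proof.
have [/(_ c y (sub Oy)) [symg _] _] := NHg.
by apply: ev_bil_inj => u v; rewrite symg ev_bil_tr trmxK.
Qed.

Let g_unit y (Oy : O y) : g c y \in unitmx.
Proof.
by have [/(_ c y (sub Oy)) [_ /has_signature_unit]] := NHg.
Qed.

Let J_unit y (Oy : O y) a : J a c y \in unitmx.
Proof. by apply: sqr_oppr1_unit; have [] := hypJ (sub Oy) a. Qed.

Let nablaJ2 y (Oy : O y) u v : nabla_endo (nabla c) (J i2 c) y u v =
  (ev_form (omega i i1 c y) u *: J i3 c y
   - ev_form (omega i i3 c y) u *: J i1 c y) *m v.
Proof.
have [_ _ /(_ i c y Oy i2 u v) /=] := QK.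
by rewrite -/i3 ordS_i3 mulmxDl mulNmx -!scalemxAl.
Qed.

Let nablaJ3 y (Oy : O y) u v : nabla_endo (nabla c) (J i3 c) y u v =
  (ev_form (omega i i2 c y) u *: J i1 c y
   - ev_form (omega i i1 c y) u *: J i2 c y) *m v.
Proof.
have [_ _ /(_ i c y Oy i3 u v) /=] := QK.
by rewrite ordS_i3 -/i2 mulmxDl mulNmx -!scalemxAl.
Qed.

Let o : 'I_(4 * n).
Proof. by exists 0%N; rewrite muln_gt0. Defined.

(** A self-adjoint matrix has no component along the skew J_1. *)
Let skew_coef_eq0 y (Oy : O y) (r s : R) (A N : 'M[R]_(4 * n)) :
  A^T *m g c y = g c y *m A -> N = r *: A + s *: J i1 c y ->
  N^T *m g c y = g c y *m N -> s = 0.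
Proof.
move=> symA -> E.
have : (s + s) *: (g c y *m J i1 c y) = 0.
  move: E; rewrite linearD !linearZ /= mulmxDl mulmxDr -!scalemxAl -!scalemxAr.
  rewrite symA adj1// => /addrI /eqP.
  by rewrite scalerN eq_sym -addr_eq0 -scalerDl => /eqP.
move/(scalemx_unit_eq0 o); rewrite unitmx_mul g_unit// J_unit// => /(_ isT).
lra.
Qed.

(** nabla J_2 = omega_1 J_3 - omega_3 J_1 is self-adjoint. *)
Lemma omega3_eq0 y u : O y -> ev_form (omega i i3 c y) u = 0.
Proof.
move=> Oy; apply/eqP; rewrite -oppr_eq0; apply/eqP.
have := nabla_endo_selfadjoint openO Oy smg (smJ i2) parg adj2 (nablaJ2 Oy u).
apply: (skew_coef_eq0 Oy (adj3 Oy) _).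
by rewrite scaleNr; reflexivity.
Qed.

(** nabla J_3 = omega_2 J_1 - omega_1 J_2 is self-adjoint. *)
Lemma omega2_eq0 y u : O y -> ev_form (omega i i2 c y) u = 0.
Proof.
move=> Oy.
have := nabla_endo_selfadjoint openO Oy smg (smJ i3) parg adj3 (nablaJ3 Oy u).
apply: (skew_coef_eq0 Oy (adj2 Oy) _).
by rewrite -scaleNr addrC; reflexivity.
Qed.

(** Since omega_2 and omega_3 vanish, nabla J_2 = omega_1 J_3 and
    nabla J_3 = - omega_1 J_2. *)
Lemma curv_mx_eq0_iff_closed x : O x ->
  (forall u v, curv_mx (nabla c) x u v = 0) <->
  (forall u v, ext_d (nabla c) (omega i i1 c) x u v = 0).
Proof.
move=> Ox.
(* The factors 1 and - 1 are the constants r and s of [curv_mx_rotation]. *)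
have n2 y (Oy : O y) u v : nabla_endo (nabla c) (J i2 c) y u v =
    (1 * ev_form (omega i i1 c y) u) *: (J i3 c y *m v).
  by rewrite nablaJ2// omega3_eq0// scale0r subr0 mul1r scalemxAl.
have n3 y (Oy : O y) u v : nabla_endo (nabla c) (J i3 c) y u v =
    (- 1 * ev_form (omega i i1 c y) u) *: (J i2 c y *m v).
  rewrite nablaJ3// omega2_eq0// scale0r sub0r mulN1r scaleNr mulNmx.
  by rewrite scalemxAl.
have R2 u v := curv_mx_rotation openO smG u v Ox
  (smJ i2) (smJ i3) (smw i1) n2 n3.
have R3 u v := curv_mx_rotation openO smG u v Ox
  (smJ i3) (smJ i2) (smw i1) n3 n2.
have dE u v := ext_dE (omega i i1 c) (tf Ox u v).
split=> [K0 u v|dw0].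
  apply: (scalemx_unit_eq0 o (J_unit Ox i3)).
  have := R2 u v; rewrite K0 mul0mx mulmx0 subrr mul1r -dE.
  by move=> <-.
have [J1E J1N _] := hypJ (sub Ox) i1; rewrite -/i2 -/i3 in J1E J1N.
have [_ _ J1J1] := hypJ (sub Ox) i1.
apply: (pseudo_hyperkahler_curvature_eq0 (g_sym Ox) (g_unit Ox)
  (adj2 Ox) (adj3 Ox)).
- by rewrite -J1E J1N opprK.
- by rewrite -J1E.
- exact: curv_mx_anti.
- by move=> u v w; apply: curv_mx_bianchi openO smG _ _ _ _ Ox _; exact: tf.
- by move=> u v; have S := curv_mx_skew openO smG u v Ox smg parg; exact: S.
- move=> u v; have := R2 u v; rewrite -dE dw0 mulr0 scale0r.
  by move/subr0_eq.
- move=> u v; have := R3 u v; rewrite -dE dw0 mulr0 scale0r.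
  by move/subr0_eq.
Qed.

End QuaternionicKaehlerNH.
Theorem proposition2p4 (R : realType) (n : nat)
    (M : smooth_manifold R (4 * n))
    (J : 'I_3 -> endo_field M)
    (g : bilinear_field M) (gJ : 'I_3 -> bilinear_field M)
    (nabla : affine_connection M)
    (I : Type) (U : I -> set M)
    (omega : forall i : I, 'I_3 -> one_form (U i)) :
  almost_hypercomplex J ->
  NH_metric_structure J g gJ ->
  levi_civita g nabla ->
  quaternionic_kahler J nabla omega ->
  flat nabla <->
  (forall (i : I) (c : chart M) (x : 'cV[R]_(4 * n)), in_chart c (U i) x ->
     forall u v : 'cV[R]_(4 * n),
     ext_d (nabla c) (omega i i1 c) x u v =
       - ev_form (omega i i2 c x) u * ev_form (omega i i3 c x) v
       + ev_form (omega i i3 c x) u * ev_form (omega i i2 c x) v).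
Proof.
move=> hypJ NHg LC QK.
(* In dimension 0 all tangent vectors are equal. *)
have [n0|n_gt0] := posnP n.
  have cV0 (u : 'cV[R]_(4 * n)) : u = 0.
    have dim0 : (4 * n = 0)%N by rewrite n0.
    by apply/matrixP => k; have := leq_trans (ltn_ord k) (eq_leq dim0).
  split=> [_ i c x _ u v|_ c x _ u v w]; last exact: cV0.
  by rewrite (cV0 u) (cV0 v) /ext_d subrr mulNr mulrC addNr.
have [_ cover _] := QK.
have rhs0 i c x u v : in_chart c (U i) x ->
    - ev_form (omega i i2 c x) u * ev_form (omega i i3 c x) v
    + ev_form (omega i i3 c x) u * ev_form (omega i i2 c x) v = 0.
  move=> Ox; rewrite !(omega3_eq0 hypJ NHg LC QK n_gt0 _ Ox).
  by rewrite mulr0 mul0r addr0.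
have curvE i c x (Ox : in_chart c (U i) x) u v w :
    curvature (nabla c) x u v w = curv_mx (nabla c) x u v *m w.
  apply: (curvatureE (in_chart_open openT)); last exact: in_chart_subset Ox.
  by move=> k; exact: christoffel_smooth.
split=> [flatM i c x Ox u v|dw c x [p [dp _] <-] u v w].
  rewrite rhs0//; move: u v.
  apply/(curv_mx_eq0_iff_closed hypJ NHg LC QK n_gt0 Ox) => u v.
  apply: mulmx_cV_inj => w; rewrite mul0mx -(curvE i)//.
  exact/flatM/in_chart_subset/Ox.
have [i Uip] := cover p.
have Ox : in_chart c (U i) (Defs.coord c p) by exists p.
rewrite (curvE i)// (_ : curv_mx _ _ _ _ = 0) ?mul0mx//; move: u v.
apply/(curv_mx_eq0_iff_closed hypJ NHg LC QK n_gt0 Ox) => u v.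
by rewrite dw// rhs0.
Qed.
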